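(* Let $G=(V,E,\iota)$ be a finite loopless multi-graph. Then $G$ admits a proper edge colouring $\phi:E\to\{1,2,3,\dots\}$ which is local, i.e. for every edge $e$ with end-points $x,y$, $$\phi(e)\le \max\{d(x)+\pi(x),\; d(y)+\pi(y)\}.$$
   Context: A multi-graph $G=(V,E,\iota)$ consists of a vertex set $V$, an edge set $E$ and a (not necessarily injective) map $\iota:E\to\binom{V}{2}$ assigning to each edge an unordered pair of distinct end-points. For distinct $x,y\in V$, $\pi(x,y)=|\iota^{-1}(\{x,y\})|$ is the multiplicity of the pair. The degree of $x$ is $d(x)=\sum_{y\neq x}\pi(x,y)$, and $\pi(x)=\max_{y\neq x}\pi(x,y)$ is the maximum edge multiplicity at $x$. An edge colouring is proper if no two distinct edges sharing an end-point receive the same colour. *)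

(* Defs.v *)
From mathcomp Require Import all_boot.

Set Implicit Arguments.
Unset Strict Implicit.
Unset Printing Implicit Defensive.

(* A finite loopless multi-graph (V, E, ends): [ends e] is the unordered pair
   of distinct end-points of [e], and [ends] need not be injective. *)
Record multigraph (V E : finType) := Multigraph {
  ends : E -> {set V};
  card_ends : forall e : E, #|ends e| = 2 }.

Section Multigraph.
Variables (V E : finType) (G : multigraph V E).

Definition multiplicity (x y : V) : nat := #|[set e : E | ends G e == [set x; y]]|.

Definition degree (x : V) : nat := \sum_(y : V | y != x) multiplicity x y.

(* The maximum is 0 when x is the only vertex; there are no edges then. *)
Definition max_multiplicity (x : V) : nat :=
  \max_(y : V | y != x) multiplicity x y.

Definition proper_colouring (phi : E -> nat) : Prop :=
  forall (e f : E) (x : V),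
    e != f -> x \in ends G e -> x \in ends G f -> phi e != phi f.

Definition local_colouring (phi : E -> nat) : Prop :=
  forall (e : E) (x y : V), ends G e = [set x; y] ->
    phi e <= maxn (degree x + max_multiplicity x)
                  (degree y + max_multiplicity y).

End Multigraph.

(* Main.v *)
(* Give each vertex v the palette {1, ..., d(v) + pi(v)}.  Among all proper partial
   colourings by arbitrary positive integers, take one minimising the total number
   of pairs (v, c) with c in the palette of v and absent at v.  An edge whose colour
   lies outside both palettes at its ends might as well be uncoloured, so it
   suffices to show that no edge xy is uncoloured; the palettes need not be
   respected in the course of the argument, which is what allows full Kempe swaps.
   A Vizing shift of the uncoloured edge around x does not raise the deficit; a
   Kempe swap that makes the same colour absent at x and y raises it by at most 1,
   at the far end of the chain, and colouring xy then lowers it by 2.  Hence, in a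
   minimal colouring, all the vertices reachable from y by shifts around x have
   disjoint sets of missing colours (the Kempe chain from x has only one other
   end), all of which are present at x.  As a vertex v misses at least
   pi(v) >= pi(x, v) colours, this yields more coloured edges from x to the
   reachable set than there are edges. *)
Require Import Defs.
From mathcomp Require Import all_boot.

Set Implicit Arguments.
Unset Strict Implicit.
Unset Printing Implicit Defensive.

(** * Alternating walks of two involutions *)

Section AlternatingComponents.
Variables (T : finType) (f g : T -> T).
Hypotheses (fK : involutive f) (gK : involutive g).

Definition alternating : rel T := fun u v => (v == f u) || (v == g u).

Lemma alternating_sym : connect_sym alternating.
Proof.
apply: sym_connect_sym => u v.
by congr (_ || _); apply/eqP/eqP=> ->; rewrite ?fK ?gK.
Qed.

Lemma connect_alternating_ind (P : T -> Prop) (y u : T) :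
  P y -> (forall v, P v -> P (f v)) -> (forall v, P v -> P (g v)) ->
  connect alternating y u -> P u.
Proof.
move=> Py Pf Pg /connectP[p + ->]; elim: p y Py => //= z p IHp y Py.
by case/andP=> /orP[] /eqP-> /IHp; apply; [apply: Pf | apply: Pg].
Qed.

(** Starts with [f], as the walk is meant to leave a vertex fixed by [g]. *)
Fixpoint alternating_walk (y : T) (k : nat) : T :=
  if k is j.+1 then (if odd j then g else f) (alternating_walk y j) else y.

(* The walk from [y] has no repeated step before it first stalls at a fixed
   vertex, so that all the vertices it visits in between are moved by both
   involutions. *)
Lemma alternating_end_unique (y s t : T) : g y = y ->
  connect alternating y s -> connect alternating y t -> s != y -> t != y ->
  (f s == s) || (g s == s) -> (f t == t) || (g t == t) -> s = t.
Proof.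
move=> gy ys yt sNy tNy fix_s fix_t.
pose w := alternating_walk y; pose h k := if odd k then g else f.
have hK k : involutive (h k) by rewrite /h; case: odd.
have wS k : w k.+1 = h k (w k) by [].
have wV k : h k (w k.+1) = w k by rewrite wS hK.
have hSS k : h k.+2 = h k by rewrite /h /= negbK.
have hfg k (P : (T -> T) -> Prop) : P (h k) -> P (h k.+1) -> P f /\ P g.
  by rewrite /h /=; case: odd.
have [i def_s] : exists i, s = w i.
  have closed_w k : (exists i, f (w k) = w i) /\ (exists i, g (w k) = w i).
    case: k => [|k]; first by split; [exists 1 | exists 0].
    apply: (hfg k (fun F => exists i, F (w k.+1) = w i)).
      by exists k.
    by exists k.+2.
  apply: (connect_alternating_ind (P := fun u => exists i, u = w i)) ys.
  - by exists 0.
  - by move=> _ [k ->]; case: (closed_w k).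
  - by move=> _ [k ->]; case: (closed_w k).
(* A vertex other than [y] fixed by either involution stalls the walk on the step leaving it or on
   the step that reached it. *)
have stall k : w k != y -> (f (w k) == w k) || (g (w k) == w k) ->
    (h k (w k) == w k) || (0 < k) && (h k.-1 (w k.-1) == w k.-1).
  case: k => [|k]; first by rewrite eqxx.
  move=> _ fix_k; rewrite -wS /= -/(w k) -/(w k.+1) -wS.
  suff: (h k.+1 (w k.+1) == w k.+1) || (h k (w k.+1) == w k.+1).
    by rewrite wV (eq_sym (w k)).
  by move: fix_k; rewrite /h /=; case: odd => //=; rewrite orbC.
have ex_stall : exists k, h k (w k) == w k.
  rewrite def_s in sNy fix_s; have [?|/andP[_ ?]] := orP (stall i sNy fix_s).
    by exists i.
  by exists i.-1.
case: (ex_minnP ex_stall) => K /eqP stallK minK.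
(* Up to its first stall [K] the walk is closed under both involutions, so it fills the component;
   an end [w j] other than [y] forces a stall at [j] or [j - 1], whence [j = K] by minimality. *)
suff last_end u : connect alternating y u -> u != y ->
    (f u == u) || (g u == u) -> u = w K.
  by rewrite (last_end s) // (last_end t).
move=> yu uNy fix_u.
have closed_w k : k <= K -> (exists2 j, j <= K & f (w k) = w j) /\
    (exists2 j, j <= K & g (w k) = w j).
  move=> le_kK; apply: (hfg k (fun F => exists2 j, j <= K & F (w k) = w j)).
    move: le_kK; rewrite leq_eqVlt => /orP[/eqP->|lt_kK]; first by exists K.
    by exists k.+1.
  case: k le_kK => [|k] lt_kK; first by exists 0.
  by exists k; rewrite ?hSS ?wV // ltnW.
have [j le_jK def_u] : exists2 j, j <= K & u = w j.
  apply: (connect_alternating_ind (P := fun v => exists2 j, j <= K & v = w j)) yu.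
  - by exists 0.
  - by move=> _ [k /closed_w[fP _] ->].
  - by move=> _ [k /closed_w[_ gP] ->].
rewrite def_u in uNy fix_u *.
have [/minK le_Kj|/andP[j_gt0 /minK]] := orP (stall j uNy fix_u).
  by congr w; apply/eqP; rewrite eqn_leq le_jK.
by rewrite -ltnS prednK // ltnNge le_jK.
Qed.

End AlternatingComponents.

Lemma leq_card_bigcup (I T : finType) (P : pred I) (A : I -> {set T}) :
  #|\bigcup_(i | P i) A i| <= \sum_(i | P i) #|A i|.
Proof.
elim/big_rec2: _ => [|i n B _ le_B]; first by rewrite cards0.
by rewrite (leq_trans (leq_card_setU _ _)) // leq_add2l.
Qed.

(** * Partial edge colourings and Kempe components *)

Section Colourings.
Variables (V E : finType) (G : multigraph V E).
Implicit Types (phi psi : E -> nat) (u v x y z : V) (e f : E) (a b c : nat).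

Lemma ends_other e v :
  v \in ends G e -> exists2 u, u != v & ends G e = [set v; u].
Proof.
have /eqP/cards2P[s [t [sNt ->]]] := card_ends G e.
rewrite !inE => /orP[] /eqP->; [exists t | exists s] => //.
  by rewrite eq_sym.
by rewrite setUC.
Qed.

Lemma ends_neq e u v : ends G e = [set v; u] -> u != v.
Proof. by move=> Ee; move: (card_ends G e); rewrite Ee cards2 eq_sym; case: eqP. Qed.

Lemma set2_inj v u w : u != v -> w != v -> [set v; u] = [set v; w] -> u = w.
Proof.
move=> uNv wNv /setP/(_ u); rewrite !inE eqxx orbT (negPf uNv).
by move/esym/eqP.
Qed.

(* Colour 0 means uncoloured. *)
Definition partial_proper phi : bool :=
  [forall e, forall f, forall v,
     [&& e != f, v \in ends G e, v \in ends G f & phi e == phi f]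
     ==> (phi e == 0)].

Lemma partial_properP phi :
  reflect (forall e f v, e != f -> v \in ends G e -> v \in ends G f ->
             phi e = phi f -> phi e = 0)
          (partial_proper phi).
Proof.
apply: (iffP forallP) => [+ e f v eNf ve vf Eef|phiP e].
  by move=> /(_ e)/forallP/(_ f)/forallP/(_ v); rewrite eNf ve vf Eef eqxx /= => /eqP.
apply/forallP=> f; apply/forallP=> v; apply/implyP=> /and4P[eNf ve vf /eqP Eef].
by apply/eqP; apply: (phiP e f v).
Qed.

Definition uses phi v c : bool := [exists e, (v \in ends G e) && (phi e == c)].

Lemma usesP phi v c :
  reflect (exists2 e, v \in ends G e & phi e = c) (uses phi v c).
Proof.
by apply: (iffP existsP) => [[e /andP[ve /eqP]]|[e ve /eqP Ee]]; exists e; rewrite ?ve.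
Qed.

(** Defaulting to [v] makes this an involution of the vertices for each positive colour of a proper
    [phi], so that Kempe chains become alternating walks. *)
Definition mate phi c v : V :=
  if [pick u | [exists e, (ends G e == [set v; u]) && (phi e == c)]] is Some u
  then u else v.

Lemma mate_edge phi e c v u : partial_proper phi -> 0 < c ->
  ends G e = [set v; u] -> phi e = c -> mate phi c v = u.
Proof.
move=> /partial_properP phiP c_gt0 Ee Ce; rewrite /mate; case: pickP => [w|/(_ u)].
  case/existsP=> f /andP[/eqP Ef /eqP Cf].
  have [eqef|eNf] := eqVneq f e.
    by apply: (@set2_inj v) (ends_neq Ef) (ends_neq Ee) _; rewrite -Ef -Ee eqef.
  have := phiP f e v eNf; rewrite Ef Ee !inE eqxx Ce Cf => /(_ isT isT erefl).
  by move=> c0; rewrite c0 in c_gt0.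
by move/existsP; case; exists e; rewrite Ee Ce !eqxx.
Qed.

Lemma mate_id phi c v : ~~ uses phi v c -> mate phi c v = v.
Proof.
move=> /usesP unused; rewrite /mate; case: pickP => // w /existsP[f /andP[/eqP Ef /eqP Cf]].
by case: unused; exists f; rewrite // Ef !inE eqxx.
Qed.

Lemma mateK phi c : partial_proper phi -> 0 < c -> involutive (mate phi c).
Proof.
move=> phiP c_gt0 v; have [/usesP[e ve Ce]|unused] := boolP (uses phi v c).
  have [u _ Ee] := ends_other ve; rewrite (mate_edge phiP c_gt0 Ee Ce).
  by apply: mate_edge Ce => //; rewrite setUC.
by rewrite !mate_id.
Qed.

Lemma eq_mate phi psi c :
  (forall e, (phi e == c) = (psi e == c)) -> mate phi c =1 mate psi c.
Proof.
move=> eqc v; rewrite /mate; congr (if _ is Some u then u else v).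
by apply: eq_pick => u; apply: eq_existsb => e; rewrite eqc.
Qed.

Definition kempe phi a b : rel V := connect (alternating (mate phi a) (mate phi b)).

Lemma eq_kempe phi psi a b :
  (forall e, (phi e == a) = (psi e == a)) ->
  (forall e, (phi e == b) = (psi e == b)) -> kempe phi a b =2 kempe psi a b.
Proof.
move=> /eq_mate eqa /eq_mate eqb; apply: eq_connect => u v.
by rewrite /alternating eqa eqb.
Qed.

Lemma kempe_sym phi a b : partial_proper phi -> 0 < a -> 0 < b ->
  symmetric (kempe phi a b).
Proof. by move=> phiP a0 b0; apply: alternating_sym; apply: mateK. Qed.

Lemma kempe_end_unique phi a b y s t : partial_proper phi -> 0 < a -> 0 < b ->
  ~~ uses phi y b -> kempe phi a b y s -> kempe phi a b y t ->
  s != y -> t != y -> ~~ (uses phi s a && uses phi s b) ->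
  ~~ (uses phi t a && uses phi t b) -> s = t.
Proof.
move=> phiP a0 b0 yb ys yt sNy tNy s_end t_end.
have fixed v : ~~ (uses phi v a && uses phi v b) ->
    (mate phi a v == v) || (mate phi b v == v).
  by rewrite negb_and => /orP[] /mate_id->; rewrite eqxx ?orbT.
apply: (alternating_end_unique (mateK phiP a0) (mateK phiP b0) (mate_id yb) ys yt) => //.
all: exact: fixed.
Qed.

Lemma kempe_edge phi a b y e u v : partial_proper phi -> 0 < a -> 0 < b ->
  (phi e == a) || (phi e == b) -> u \in ends G e -> v \in ends G e ->
  kempe phi a b y u = kempe phi a b y v.
Proof.
move=> phiP a0 b0 Ce.
suff step s t : s \in ends G e -> t \in ends G e ->
    kempe phi a b y s -> kempe phi a b y t.
  by move=> ue ve; apply/idP/idP; apply: step.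
move=> {u v} se te ys; apply: connect_trans ys _.
have [w _ Ee] := ends_other se; move: te; rewrite Ee !inE => /orP[]/eqP->.
  exact: connect0.
apply: connect1; rewrite /alternating.
by case/orP: Ce => /eqP Ce; rewrite (mate_edge phiP _ Ee Ce) ?eqxx ?orbT.
Qed.


(** * Palettes, missing colours and the deficit *)

Variable palette : V -> nat.

Definition missing phi v c : bool := (0 < c <= palette v) && ~~ uses phi v c.

Definition slack phi v : nat := count (missing phi v) (iota 1 (palette v)).

Definition deficit phi : nat := \sum_v slack phi v.

(* The colours of [psi] are not confined to the palettes. *)
Definition optimal phi : Prop :=
  partial_proper phi /\
  forall psi, partial_proper psi -> deficit phi <= deficit psi.

Lemma slack_le phi psi v :
  (forall c, missing psi v c -> missing phi v c) -> slack psi v <= slack phi v.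
Proof. by move=> sub; apply: sub_count => c /sub. Qed.

Lemma slack_leS phi psi v a :
  (forall c, missing psi v c -> missing phi v c || (c == a)) ->
  slack psi v <= (slack phi v).+1.
Proof.
move=> sub; have/leq_trans-> // : slack psi v <=
    count (predU (missing phi v) (pred1 a)) (iota 1 (palette v)).
  exact: sub_count.
rewrite -[leqRHS]addn1 -(leq_add2r (count (predI (missing phi v) (pred1 a)) (iota 1 (palette v)))).
rewrite count_predUI -addnA leq_add2l count_uniq_mem ?iota_uniq //.
by rewrite (leq_trans (leq_b1 _)) // leq_addr.
Qed.

Lemma slack_lt phi psi v a : missing phi v a ->
  (forall c, missing psi v c -> missing phi v c && (c != a)) ->
  slack psi v < slack phi v.
Proof.
move=> va sub; have: count (predU (missing psi v) (pred1 a)) (iota 1 (palette v))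
    <= slack phi v.
  by apply: sub_count => c /= /orP[/sub/andP[]|/eqP->].
apply: leq_trans; rewrite -[leqRHS]addn0.
have {2}<- : count (predI (missing psi v) (pred1 a)) (iota 1 (palette v)) = 0.
  apply: etrans (count_pred0 (iota 1 (palette v))); apply: eq_count => c /=.
  by apply/negP=> /andP[/sub/andP[_ /negP]].
rewrite count_predUI -addn1 leq_add2l count_uniq_mem ?iota_uniq // mem_iota.
by case/andP: va; rewrite add1n ltnS => ->.
Qed.

Lemma uses_edge phi v e : v \in ends G e -> uses phi v (phi e).
Proof. by move=> ve; apply/usesP; exists e. Qed.

Lemma fill_proper phi e x y a : partial_proper phi -> ends G e = [set x; y] ->
  ~~ uses phi x a -> ~~ uses phi y a -> partial_proper [eta phi with e |-> a].
Proof.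
move=> /partial_properP phiP Ee xa ya.
have unused v : v \in ends G e -> ~~ uses phi v a.
  by rewrite Ee !inE => /orP[] /eqP->.
apply/partial_properP=> f g v fNg vf vg /=.
have [fe|_] := eqVneq f e; have [ge|_] := eqVneq g e => Efg.
- by rewrite fe ge eqxx in fNg.
- by rewrite fe in vf; case/negP: (unused v vf); rewrite Efg uses_edge.
- by rewrite ge in vg; case/negP: (unused v vg); rewrite -Efg uses_edge.
- exact: phiP vf vg Efg.
Qed.

Lemma uses_fill phi e a v c : phi e = 0 -> 0 < c ->
  uses [eta phi with e |-> a] v c = uses phi v c || (v \in ends G e) && (c == a).
Proof.
move=> e0 c_gt0; apply/usesP/orP => [[f vf /=]|[/usesP[f vf Cf]|/andP[ve /eqP->]]].
- case: eqP vf => [-> ve ->|_ vf <-]; first by right; rewrite ve eqxx.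
  by left; apply: uses_edge.
- exists f => //=; case: eqP Cf => // ->; rewrite e0 => c0.
  by rewrite -c0 in c_gt0.
- by exists e; rewrite //= eqxx.
Qed.

Definition colour_swap a b c : nat :=
  if c == a then b else if c == b then a else c.

Lemma colour_swapK a b : involutive (colour_swap a b).
Proof.
move=> c; rewrite /colour_swap; have [->|cNa] := eqVneq c a.
  by rewrite eqxx; case: eqP.
have [->|cNb] := eqVneq c b; first by rewrite eqxx.
by rewrite (negPf cNa) (negPf cNb).
Qed.

Lemma colour_swap0 a b c : 0 < a -> 0 < b -> (colour_swap a b c == 0) = (c == 0).
Proof.
move=> a0 b0; rewrite -(inj_eq (inv_inj (colour_swapK a b))) colour_swapK.
by rewrite /colour_swap (ltn_eqF a0) (ltn_eqF b0).
Qed.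

Definition kempe_swap phi a b y e : nat :=
  if [exists v, (v \in ends G e) && kempe phi a b y v]
  then colour_swap a b (phi e) else phi e.

(** * Kempe changes *)

Section KempeSwap.
Variables (phi : E -> nat) (a b : nat) (y : V).
Hypotheses (phiP : partial_proper phi) (a_gt0 : 0 < a) (b_gt0 : 0 < b).

(** An edge coloured [a] or [b] has both ends in one component, and any other colour is fixed by the
    swap, so either end decides. *)
Lemma kempe_swapE e v : v \in ends G e ->
  kempe_swap phi a b y e =
  if kempe phi a b y v then colour_swap a b (phi e) else phi e.
Proof.
move=> ve; have [Ce|/norP[eNa eNb]] := boolP ((phi e == a) || (phi e == b)).
  congr (if _ then _ else _); apply/existsP/idP => [[u /andP[ue]]|yv].
    by rewrite (kempe_edge y phiP a_gt0 b_gt0 Ce ue ve).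
  by exists v; rewrite ve.
by rewrite /kempe_swap /colour_swap (negPf eNa) (negPf eNb) !if_same.
Qed.

Lemma kempe_swap_proper : partial_proper (kempe_swap phi a b y).
Proof.
apply/partial_properP=> e f v eNf ve vf; rewrite !(kempe_swapE (v := v)) //.
move/partial_properP: phiP => inj; case: ifP => _; last exact: inj vf.
move/(inv_inj (colour_swapK a b)) => Eef.
by apply/eqP; rewrite colour_swap0 // (inj e f v).
Qed.

Lemma uses_kempe_swap v c : uses (kempe_swap phi a b y) v c =
  uses phi v (if kempe phi a b y v then colour_swap a b c else c).
Proof.
apply: eq_existsb => e; case: (boolP (v \in _)) => //= ve.
rewrite (kempe_swapE ve); case: ifP => // _.
by rewrite -(inj_eq (inv_inj (colour_swapK a b))) colour_swapK.
Qed.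

End KempeSwap.

(** Writes a change of one at a single vertex as a sum over all vertices, so that deficits can be
    compared vertex by vertex. *)
Lemma sum_pred1 x : \sum_v (v == x : nat) = 1.
Proof. by rewrite (bigD1 x) //= eqxx big1 // => v /negPf->. Qed.

(** * An uncoloured edge in an optimal colouring *)

Section Optimal.
Variables (phi : E -> nat) (e0 : E) (x y : V).
Hypotheses (opt : optimal phi) (e0_0 : phi e0 = 0) (Ee0 : ends G e0 = [set x; y]).

Let phiP : partial_proper phi := opt.1.

(** Otherwise colouring [e0] with [a] lowers the slack at [x] and raises it nowhere, even if [a]
    lies outside the palette of [y]. *)
Lemma uses_of_missing_centre a : missing phi x a -> uses phi y a.
Proof.
move=> xa; apply: contraT => ya.
have /andP[/andP[a_gt0 _] xNa] := xa.
have := opt.2 _ (fill_proper phiP Ee0 xNa ya); rewrite leqNgt => /negP[].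
rewrite /deficit -addn1 -(sum_pred1 x) -big_split /=.
apply: leq_sum => v _; case: eqP => [->|_]; rewrite ?addn1 ?addn0.
  apply: slack_lt (xa) _ => c /andP[/andP[c_gt0 c_le]].
  rewrite uses_fill // Ee0 !inE eqxx /= => /norP[xNc cNa].
  by rewrite /missing c_gt0 c_le xNc.
apply: slack_le => c /andP[/andP[c_gt0 c_le]].
by rewrite uses_fill // => /norP[vNc _]; rewrite /missing c_gt0 c_le.
Qed.

(** Otherwise swapping the chain of [y] frees [a] at [y] and leaves [x] alone, so [e0] can take [a]:
    the slack drops at [x] and at [y], and rises by at most one at the other end of the chain. *)
Lemma kempe_centre a b : missing phi x a -> missing phi y b -> kempe phi a b y x.
Proof.
move=> xa yb; apply: contraT => yNx.
have ya := uses_of_missing_centre xa.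
have /andP[/andP[a_gt0 _] xNa] := xa; have /andP[/andP[b_gt0 _] yNb] := yb.
have aNb : a != b by apply: contraNneq yNb => <-.
have xNy : y != x := ends_neq Ee0.
have swapa : colour_swap a b a = b by rewrite /colour_swap eqxx.
have swapb : colour_swap a b b = a by rewrite /colour_swap eqxx eq_sym (negPf aNb).
have yy : kempe phi a b y y := connect0 _ _.
pose psi := kempe_swap phi a b y.
have psiE := uses_kempe_swap y phiP a_gt0 b_gt0.
have psi0 : psi e0 = 0.
  have ye0 : y \in ends G e0 by rewrite Ee0 !inE eqxx orbT.
  by rewrite /psi (kempe_swapE y phiP a_gt0 b_gt0 ye0) yy e0_0 /colour_swap (ltn_eqF a_gt0) (ltn_eqF b_gt0).
have psiP : partial_proper [eta psi with e0 |-> a].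
  apply: fill_proper Ee0 _ _; first exact: kempe_swap_proper.
    by rewrite psiE (negPf yNx).
  by rewrite psiE yy swapa.
have missE v c : missing [eta psi with e0 |-> a] v c =
    [&& 0 < c <= palette v,
        ~~ uses phi v (if kempe phi a b y v then colour_swap a b c else c)
      & ~~ ((v \in [set x; y]) && (c == a))].
  rewrite /missing; case: (posnP c) => [->//|c_gt0] /=.
  by rewrite uses_fill // Ee0 negb_or psiE.
pose is_end v := [&& kempe phi a b y v, v != y & ~~ (uses phi v a && uses phi v b)].
(* The far end of the chain; if there is none, the default [y] merely leaves one unit of spare
   room. *)
pose t := odflt y [pick v | is_end v].
have tP v : is_end v -> v = t.
  rewrite /t; case: pickP => [w /and3P[yw wNy w_end]|/(_ v)->//] /and3P[yv vNy v_end].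
  exact: (kempe_end_unique phiP a_gt0 b_gt0 yNb yv yw).
have := opt.2 _ psiP; rewrite leqNgt => /negP[].
suff : deficit [eta psi with e0 |-> a] + \sum_v (v == x) + \sum_v (v == y)
    <= deficit phi + \sum_v (v == t).
  by rewrite !sum_pred1 !addn1.
rewrite -!big_split /=; apply: leq_sum => v _.
have [->|vNx] := eqVneq v x.
  rewrite (eq_sym x) (negPf xNy) addn0 addn1 (leq_trans _ (leq_addr _ _)) //.
  apply: slack_lt xa _ => c; rewrite missE (negPf yNx) !inE eqxx /=.
  by rewrite /missing => /and3P[-> -> ->].
(* The swap makes [y] use [b] and lose [a], which [e0] restores. *)
rewrite addn0; have [->|vNy] := eqVneq v y.
  rewrite addn1 (leq_trans _ (leq_addr _ _)) //.
  apply: slack_lt yb _ => c; rewrite missE yy !inE eqxx orbT /=.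
  rewrite /missing => /and3P[-> + cNa]; have [->|cNb] := eqVneq c b.
    by rewrite swapb ya.
  by rewrite /colour_swap (negPf cNa) (negPf cNb) => ->.
rewrite addn0.
have missE' c : missing [eta psi with e0 |-> a] v c = (0 < c <= palette v) &&
        ~~ uses phi v (if kempe phi a b y v then colour_swap a b c else c).
  by rewrite missE !inE (negPf vNx) (negPf vNy) andbT.
have [yv|yNv] := boolP (kempe phi a b y v); last first.
  rewrite (leq_trans _ (leq_addr _ _)) //; apply: slack_le => c.
  by rewrite missE' (negPf yNv).
rewrite yv in missE'.
have [v_end|v_mid] := boolP (~~ (uses phi v a && uses phi v b)).
  rewrite -(tP v) ?eqxx ?addn1; last by rewrite /is_end yv vNy.
  (* An end uses at most one of [a], [b]: only [a] can become missing if it is used, and only [b]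
     otherwise. *)
  apply: (@slack_leS _ _ _ (if uses phi v a then a else b)) => c.
  rewrite missE' /missing => /andP[->] /=.
  have [->|cNa] := eqVneq c a.
    by case: (uses phi v a); rewrite ?eqxx ?orbT.
  have [->|cNb] := eqVneq c b.
    by rewrite swapb => /negPf->; rewrite eqxx orbT.
  by rewrite /colour_swap (negPf cNa) (negPf cNb) => ->.
rewrite (leq_trans _ (leq_addr _ _)) //; apply: slack_le => c.
rewrite missE' /missing => /andP[->] /=; move: v_mid; rewrite negbK => /andP[va vb].
have [->|cNa] := eqVneq c a; first by rewrite swapa vb.
have [->|cNb] := eqVneq c b; first by rewrite swapb va.
by rewrite /colour_swap (negPf cNa) (negPf cNb).
Qed.

End Optimal.

(** If an edge from [x] to [y] is uncoloured, it can take over the colour of [e], leaving [e]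
    uncoloured; reachability under these arcs gives the Vizing fan. *)
Definition fan_arc phi x : rel V := fun y z =>
  [exists e, (ends G e == [set x; z]) && missing phi y (phi e)].

Definition shift phi e0 e : E -> nat := [eta phi with e0 |-> phi e, e |-> 0].

(** * Discarding colours outside the palettes; existence of an optimal colouring *)

Definition discard phi e : nat :=
  if [exists v, (v \in ends G e) && (phi e <= palette v)] then phi e else 0.

Lemma discard_proper phi : partial_proper phi -> partial_proper (discard phi).
Proof.
move=> /partial_properP phiP; apply/partial_properP=> e f v eNf ve vf.
by rewrite /discard; case: ifP => // _; case: ifP => // _; apply: phiP vf.
Qed.

(** An edge at [v] whose colour is in the palette of [v] is never discarded, so the deficit does not
    see the operation. *)
Lemma missing_discard phi v c : missing (discard phi) v c = missing phi v c.
Proof.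
rewrite /missing; case: (posnP c) => // c_gt0; case: leqP => //= c_le.
congr (~~ _); apply: eq_existsb => e; case: (boolP (v \in _)) => //= ve.
rewrite /discard; case: existsP => // none.
rewrite (ltn_eqF c_gt0); apply/esym/eqP => Ce.
by case: none; exists v; rewrite ve Ce.
Qed.

Lemma deficit_discard phi : deficit (discard phi) = deficit phi.
Proof. by apply: eq_bigr => v _; apply: eq_count => c; apply: missing_discard. Qed.

Lemma optimal_discard phi : optimal phi -> optimal (discard phi).
Proof. by case=> phiP min; split; rewrite ?deficit_discard //; apply: discard_proper. Qed.

(** Discarding keeps the deficit and bounds all colours by the largest palette size, so a minimum
    over the finitely many colourings with bounded colours is a minimum over all. *)
Lemma optimal_exists : exists phi, optimal phi.
Proof.
pose n := \max_v palette v.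
pose nat_of (f : {ffun E -> 'I_n.+1}) e : nat := f e.
have proper0 : partial_proper (nat_of [ffun=> ord0]).
  by apply/partial_properP=> e f v _ _ _ _; rewrite /nat_of ffunE.
case: (arg_minnP (P := fun h => partial_proper (nat_of h))
  (fun h => deficit (nat_of h)) proper0) => h hP min_h.
exists (nat_of h); split=> // psi psiP.
pose g : {ffun E -> 'I_n.+1} := [ffun e => inord (discard psi e)].
have gE : nat_of g =1 discard psi.
  move=> e; rewrite /nat_of ffunE inordK // ltnS /discard.
  case: existsP => // -[v /andP[_ le_v]]; apply: leq_trans le_v _.
  exact: leq_bigmax.
have g_uses v c : uses (nat_of g) v c = uses (discard psi) v c.
  by apply: eq_existsb => e; rewrite gE.
have gP : partial_proper (nat_of g).
  apply/partial_properP=> e f v; rewrite !gE.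
  by move/partial_properP: (discard_proper psiP); apply.
apply: leq_trans (min_h g gP) _; rewrite -(deficit_discard psi).
by apply: leq_sum => v _; apply: slack_le => c; rewrite /missing g_uses.
Qed.

(** * Vizing shifts and fans *)

Section Shift.
Variables (phi : E -> nat) (e0 e : E) (x y z : V).
Hypotheses (opt : optimal phi) (e0_0 : phi e0 = 0) (Ee0 : ends G e0 = [set x; y]).
Hypotheses (Ee : ends G e = [set x; z]) (y_e : missing phi y (phi e)).

Let phiP : partial_proper phi := opt.1.
Let psi := shift phi e0 e.

Let e_gt0 : 0 < phi e. Proof. by case/andP: y_e => /andP[]. Qed.

Let eNe0 : (e == e0) = false.
Proof. by apply/eqP => Eee0; move: e_gt0; rewrite Eee0 e0_0. Qed.

Let xe : x \in ends G e. Proof. by rewrite Ee !inE eqxx. Qed.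

Let ze : z \in ends G e. Proof. by rewrite Ee !inE eqxx orbT. Qed.

Lemma fan_arc_neq : z != y.
Proof. by apply: contraTneq (y_e) => <-; rewrite /missing uses_edge // andbF. Qed.

Lemma shift_uncoloured : psi e = 0.
Proof. by rewrite /psi /shift /= eNe0 eqxx. Qed.

Lemma shift_same f : f != e0 -> f != e -> psi f = phi f.
Proof. by rewrite /psi /shift /= => /negPf-> /negPf->. Qed.

Lemma shift_other c f : 0 < c -> c != phi e -> (phi f == c) = (psi f == c).
Proof.
move=> c_gt0 cNe; rewrite /psi /shift /=; have [->|_] := eqVneq f e0.
  by rewrite e0_0 (ltn_eqF c_gt0) eq_sym (negPf cNe).
by have [->|//] := eqVneq f e; rewrite eq_sym (negPf cNe) (ltn_eqF c_gt0).
Qed.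

Lemma uses_shift_other v c : 0 < c -> c != phi e -> uses psi v c = uses phi v c.
Proof. by move=> c_gt0 cNe; apply: eq_existsb => f; rewrite shift_other. Qed.

Lemma uses_shift_away v c : v != y -> v != z -> 0 < c -> uses psi v c = uses phi v c.
Proof.
move=> vNy vNz c_gt0; have [->|/uses_shift_other->//] := eqVneq c (phi e).
have [->|vNx] := eqVneq v x.
  rewrite uses_edge //; apply/usesP; exists e0; first by rewrite Ee0 !inE eqxx.
  by rewrite /psi /shift /= eqxx.
apply: eq_existsb => f; case: (boolP (v \in _)) => //= vf.
by rewrite shift_same //; apply: contraTneq vf => ->;
  rewrite ?Ee ?Ee0 !inE negb_or vNx.
Qed.

Lemma missing_shift_away v c : v != y -> v != z -> missing psi v c = missing phi v c.
Proof.
move=> vNy vNz; rewrite /missing; case: (posnP c) => // c_gt0.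
by rewrite uses_shift_away.
Qed.

Lemma missing_shift_other v c : c != phi e -> missing psi v c = missing phi v c.
Proof.
move=> cNe; rewrite /missing; case: (posnP c) => // c_gt0.
by rewrite uses_shift_other.
Qed.

Lemma unused_shift_end : ~~ uses psi z (phi e).
Proof.
have zNx := ends_neq Ee; have zNy := fan_arc_neq.
apply/usesP=> -[f zf]; rewrite /psi /shift /=.
have [fe0|_] := eqVneq f e0.
  by move: zf; rewrite fe0 Ee0 !inE (negPf zNx) (negPf zNy).
have [_ e0'|fNe Cf] := eqVneq f e; first by move: e_gt0; rewrite -e0'.
move/partial_properP: phiP => /(_ f e z fNe zf ze Cf) f0.
by move: e_gt0; rewrite -Cf f0.
Qed.

(** [e0] receives a colour absent at [y] and carried at [x] by [e] alone, which loses it. *)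
Lemma shift_proper : partial_proper psi.
Proof.
move/partial_properP: (phiP) => inj; have /andP[_ yNe] := y_e.
have unused v f : v \in ends G e0 -> v \in ends G f -> f != e -> phi f != phi e.
  rewrite Ee0 !inE => /orP[] /eqP-> vf fNe; last first.
    by apply: contra yNe => /eqP<-; apply: uses_edge.
  apply: contraTneq (e_gt0) => Cf; rewrite -Cf (inj f e x) //.
apply/partial_properP=> f g v fNg vf vg; rewrite /psi /shift /=.
have [fe0|_] := eqVneq f e0; have [ge0|_] := eqVneq g e0.
- by rewrite fe0 ge0 eqxx in fNg.
- rewrite fe0 in vf; have [_ //|gNe Cg] := eqVneq g e.
  by have := unused v g vf vg gNe; rewrite Cg eqxx.
- rewrite ge0 in vg; have [//|fNe Cf] := eqVneq f e.
  by have := unused v f vg vf fNe; rewrite Cf eqxx.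
have [//|_] := eqVneq f e; have [_ f0|_] := eqVneq g e => //; exact: (inj f g v).
Qed.

Lemma missing_shift_start c : missing psi y c -> missing phi y c && (c != phi e).
Proof.
have [->|cNe] := eqVneq c (phi e); last by rewrite missing_shift_other // andbT.
case/andP=> _ /usesP[]; exists e0; first by rewrite Ee0 !inE eqxx orbT.
by rewrite /psi /shift /= eqxx.
Qed.

Lemma missing_shift_end c : missing psi z c -> missing phi z c || (c == phi e).
Proof. by have [|/missing_shift_other->] := eqVneq c (phi e); rewrite ?orbT ?orbF. Qed.

(** The slack drops at [y], rises by at most one at [z] and does not rise elsewhere. *)
Lemma shift_optimal : optimal psi.
Proof.
split=> [|chi /opt.2]; first exact: shift_proper.
apply: leq_trans; rewrite -(leq_add2r 1) -{1}(sum_pred1 y) -(sum_pred1 z).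
rewrite -!big_split; apply: leq_sum => v _ /=.
have [->|vNy] := eqVneq v y.
  rewrite eq_sym (negPf fan_arc_neq) addn0 addn1; apply: slack_lt (y_e) _.
  exact: missing_shift_start.
have [->|vNz] := eqVneq v z.
  by rewrite addn0 addn1; apply: slack_leS; apply: missing_shift_end.
by rewrite !addn0; apply: slack_le => c; rewrite missing_shift_away.
Qed.

(* Otherwise [phi e] lies outside the palette of [z], and the shift would lower
   the deficit at [y] without raising it at [z]. *)
Lemma missing_shift_new : missing psi z (phi e).
Proof.
rewrite /missing unused_shift_end e_gt0 andbT leqNgt.
apply/negP=> out; have := opt.2 _ shift_proper; rewrite leqNgt => /negP[].
rewrite -addn1 -(sum_pred1 y) -big_split; apply: leq_sum => v _ /=.
have [->|vNy] := eqVneq v y.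
  by rewrite addn1; apply: slack_lt (y_e) _; apply: missing_shift_start.
rewrite addn0; apply: slack_le => c.
have [->|vNz] := eqVneq v z; last by rewrite missing_shift_away.
move=> zc; have /orP[//|/eqP Cc] := missing_shift_end zc.
by move: zc; rewrite Cc /missing (leqNgt (phi e)) out andbF.
Qed.

Lemma missing_shift_sub v c : v != y -> missing phi v c -> missing psi v c.
Proof.
move=> vNy; have [->|vNz] := eqVneq v z; last by rewrite missing_shift_away.
have [->|cNe] := eqVneq c (phi e); last by rewrite missing_shift_other.
by rewrite missing_shift_new.
Qed.

(** The arcs of [p] use edges to vertices other than [y] and [z], hence neither [e0] nor [e], and
    start at vertices other than [y], where no missing colour is lost. *)
Lemma shift_path p : path (fan_arc phi x) z p -> uniq [:: y, z & p] ->
  path (fan_arc psi x) z p.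
Proof.
have sub (q : seq V) u : u != y -> y \notin q -> z \notin q ->
    path (fan_arc phi x) u q -> path (fan_arc psi x) u q.
  elim: q u => //= w q IHq u uNy; rewrite !inE !negb_or.
  move=> /andP[yNw yNq] /andP[zNw zNq] /andP[/existsP[f /andP[/eqP Ef uf]] wq].
  rewrite IHq 1?eq_sym // andbT; apply/existsP; exists f.
  have wNx := ends_neq Ef; have wf : w \in ends G f by rewrite Ef !inE eqxx orbT.
  rewrite Ef eqxx shift_same ?missing_shift_sub //.
    apply: contraTneq wf => ->; rewrite Ee0 !inE (negPf wNx) eq_sym (negPf yNw) //.
  by apply: contraTneq wf => ->; rewrite Ee !inE (negPf wNx) eq_sym (negPf zNw).
move=> zp /= /and3P[]; rewrite inE negb_or => /andP[_ yNp] zNp _.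
by apply: sub => //; exact: fan_arc_neq.
Qed.

End Shift.

Section Fan.
Variables (x : V) (a : nat).

(** Induction on the fan path: shifting along its first arc makes [e] the uncoloured edge, and [a],
    absent at [x], is not the colour moved. *)
Lemma uses_fan phi e0 y p : optimal phi -> phi e0 = 0 -> ends G e0 = [set x; y] ->
  missing phi x a -> path (fan_arc phi x) y p -> uniq (y :: p) ->
  uses phi (last y p) a.
Proof.
elim: p phi e0 y => [|z p IHp] phi e0 y opt e0_0 Ee0 xa.
  by move=> _ _; apply: uses_of_missing_centre opt e0_0 Ee0 _ xa.
case/andP=> /existsP[e /andP[/eqP Ee ye]] zp yzp.
have xe : x \in ends G e by rewrite Ee !inE eqxx.
have /andP[/andP[a_gt0 _] xNa] := xa.
have aNe : a != phi e by apply: contraNneq xNa => ->; apply: uses_edge.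
rewrite /= -(uses_shift_other e0_0 _ a_gt0 aNe).
apply: (IHp _ e) => //.
- exact: shift_optimal opt e0_0 Ee0 Ee ye.
- exact: shift_uncoloured e0_0 ye.
- by rewrite missing_shift_other.
- exact: shift_path opt e0_0 Ee0 Ee ye _ zp yzp.
- by case/andP: yzp.
Qed.

Lemma centre_uses_fan phi e0 y p c : optimal phi -> phi e0 = 0 ->
  ends G e0 = [set x; y] -> path (fan_arc phi x) y p -> uniq (y :: p) ->
  missing phi (last y p) c -> uses phi x c.
Proof.
elim: p phi e0 y => [|z p IHp] phi e0 y opt e0_0 Ee0.
  (* The two ends of [e0] exchange roles. *)
  by move=> _ _; rewrite setUC in Ee0; apply: uses_of_missing_centre opt e0_0 Ee0 c.
case/andP=> /existsP[e /andP[/eqP Ee ye]] zp yzp last_c.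
have xNy : x != y by rewrite eq_sym (ends_neq Ee0).
have xNz : x != z by rewrite eq_sym (ends_neq Ee).
have c_gt0 : 0 < c by case/andP: last_c => /andP[].
have lNy : last z p != y by apply: contraTneq yzp => <-; rewrite /= mem_last.
rewrite -(uses_shift_away e0_0 Ee0 Ee xNy xNz c_gt0).
apply: (IHp _ e z) => //.
- exact: shift_optimal opt e0_0 Ee0 Ee ye.
- exact: shift_uncoloured e0_0 ye.
- exact: shift_path opt e0_0 Ee0 Ee ye _ zp yzp.
- by case/andP: yzp.
- exact: (missing_shift_sub opt e0_0 Ee0 Ee ye).
Qed.

(** If [y] and [z] differed, [x] lacking [a] and [z] lacking [b] would both be ends of the chain
    starting at [y], hence equal; but [z] uses [a]. *)
Lemma kempe_disjoint phi y z b : partial_proper phi ->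
  missing phi x a -> uses phi y a -> uses phi z a -> missing phi y b ->
  missing phi z b -> kempe phi a b y x -> kempe phi a b z x -> y = z.
Proof.
move=> phiP /andP[/andP[a_gt0 _] xa] ya za /andP[/andP[b_gt0 _] yb] /andP[_ zb] yx zx.
have uNx u : uses phi u a -> x != u by move=> ua; apply: contraNneq xa => ->.
rewrite (kempe_sym phiP a_gt0 b_gt0) in zx.
have yz : kempe phi a b y z := connect_trans yx zx.
apply/eqP; apply: contraT => yNz.
suff xz : x = z by rewrite -xz (negPf xa) in za.
apply: (kempe_end_unique phiP a_gt0 b_gt0 yb yx yz); rewrite ?uNx 1?eq_sym //.
  by rewrite (negPf xa).
by rewrite (negPf zb) andbF.
Qed.

(* Shifting along the path preserves the [a], [b]-component as long as no edge
   coloured [b] is moved.  If the first edge is coloured [b], then after the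
   first shift both [z] and the end of the path would miss [b]. *)
Lemma kempe_fan phi e0 y p b : optimal phi -> phi e0 = 0 ->
  ends G e0 = [set x; y] -> missing phi x a -> path (fan_arc phi x) y p ->
  uniq (y :: p) -> missing phi (last y p) b -> kempe phi a b (last y p) x.
Proof.
elim: p phi e0 y => [|z p IHp] phi e0 y opt e0_0 Ee0 xa.
  by move=> _ _; apply: kempe_centre opt e0_0 Ee0 _ _ xa.
case/andP=> /existsP[e /andP[/eqP Ee ye]] zp yzp last_b.
have xe : x \in ends G e by rewrite Ee !inE eqxx.
have /andP[/andP[a_gt0 _] xNa] := xa; have /andP[/andP[b_gt0 _] lNb] := last_b.
have aNe : a != phi e by apply: contraNneq xNa => ->; apply: uses_edge.
pose psi := shift phi e0 e.
have psi_opt : optimal psi := shift_optimal opt e0_0 Ee0 Ee ye.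
have psi0 : psi e = 0 := shift_uncoloured e0_0 ye.
have psi_xa : missing psi x a by rewrite missing_shift_other.
have psi_zp : path (fan_arc psi x) z p := shift_path opt e0_0 Ee0 Ee ye zp yzp.
have zp_uniq : uniq (z :: p) by case/andP: yzp.
have lNy : last z p != y by apply: contraTneq yzp => <-; rewrite /= mem_last.
have psi_b : missing psi (last z p) b by apply: (missing_shift_sub opt e0_0 Ee0 Ee ye).
have psi_kempe := IHp psi e z psi_opt psi0 Ee psi_xa psi_zp zp_uniq psi_b.
have [eqbe|bNe] := eqVneq b (phi e); last first.
  by rewrite /= (eq_kempe (psi := psi)) // => f; apply: shift_other.
have zb : missing psi z b by rewrite eqbe; apply: missing_shift_new opt e0_0 Ee0 Ee ye.
(* After the shift the chains of [z] and of the last vertex both lead to [x], so these vertices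
   coincide; yet before it [z] meets [e], coloured [b]. *)
case/negP: lNb; rewrite eqbe /=.
have -> : last z p = z; last by apply: uses_edge; rewrite Ee !inE eqxx orbT.
apply: (kempe_disjoint psi_opt.1 psi_xa _ _ psi_b zb psi_kempe).
- exact: uses_fan psi_opt psi0 Ee psi_xa psi_zp zp_uniq.
- exact: uses_of_missing_centre psi_opt psi0 Ee a psi_xa.
- exact: kempe_centre psi_opt psi0 Ee _ _ psi_xa zb.
Qed.

End Fan.

(** * Counting missing colours *)

Lemma card_incident v : #|[set e | v \in ends G e]| <= degree G v.
Proof.
apply: leq_trans (leq_card_bigcup _ _); apply/subset_leq_card/subsetP => e.
rewrite inE => /ends_other[u uNv Ee].
by apply/bigcupP; exists u; rewrite ?inE ?Ee.
Qed.

Lemma slack_degree phi v : palette v <= slack phi v + degree G v.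
Proof.
rewrite -{1}(size_iota 1 (palette v)) -(count_predC (missing phi v)) leq_add2l.
apply: leq_trans (card_incident v); rewrite cardE -(size_map phi) -size_filter.
apply: uniq_leq_size => [|c]; first by rewrite filter_uniq ?iota_uniq.
rewrite mem_filter mem_iota add1n ltnS /= => /andP[+ c_pal].
rewrite /missing c_pal /= negbK => /usesP[e ve <-].
by apply: map_f; rewrite mem_enum inE.
Qed.

Lemma slack_card phi v x : (forall c, missing phi v c -> uses phi x c) ->
  slack phi v <= #|[set e | (x \in ends G e) && missing phi v (phi e)]|.
Proof.
move=> x_uses; rewrite cardE -(size_map phi) /slack -size_filter.
apply: uniq_leq_size => [|c]; first by rewrite filter_uniq ?iota_uniq.
rewrite mem_filter => /andP[vc _]; have /usesP[e xe Ce] := x_uses c vc.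
by rewrite -Ce; apply: map_f; rewrite mem_enum inE xe Ce.
Qed.

Hypothesis palette_ge : forall v, degree G v + max_multiplicity G v <= palette v.

(** At most d(v) of the at least d(v) + pi(v) palette colours are present at [v]. *)
Lemma slack_multiplicity phi v x : x != v -> multiplicity G x v <= slack phi v.
Proof.
move=> xNv; rewrite -(leq_add2r (degree G v)) (leq_trans _ (slack_degree phi v)) //.
rewrite addnC (leq_trans _ (palette_ge v)) // leq_add2l.
have -> : multiplicity G x v = multiplicity G v x.
  by apply: eq_card => e; rewrite !inE setUC.
exact: (leq_bigmax_cond (F := multiplicity G v)).
Qed.

Lemma slack_missing phi v : 0 < slack phi v -> exists c, missing phi v c.
Proof. by rewrite -has_count => /hasP[c _ vc]; exists c. Qed.

(* All edges at [x] whose colour is missing at some vertex of the fan [R] end in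
   [R], as do the [slack] missing colours of each of its vertices, which are
   pairwise different; but [e0] ends in [R] as well and is not coloured. *)
Lemma optimal_coloured phi e : optimal phi -> 0 < phi e.
Proof.
move=> opt; rewrite lt0n; apply/negP=> /eqP e_0.
have /eqP/cards2P[x [y [xNy Ee]]] := card_ends G e.
have e_gt0 : 0 < multiplicity G y x.
  by apply/card_gt0P; exists e; rewrite inE Ee setUC.
have yNx : y != x by rewrite eq_sym.
have [a xa] := slack_missing (leq_trans e_gt0 (slack_multiplicity phi yNx)).
pose R := connect (fan_arc phi x) y.
have R_path v : R v ->
    exists p, [/\ path (fan_arc phi x) y p, uniq (y :: p) & v = last y p].
  by case/connectP=> p yp ->; case/shortenP: yp => q yq q_uniq _; exists q.
have R_uses v : R v -> uses phi v a.
  by case/R_path=> p [yp p_uniq ->]; apply: uses_fan e_0 Ee xa yp p_uniq.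
have R_neq v : R v -> x != v.
  by move=> /R_uses va; apply: contraTneq xa => ->; rewrite /missing va andbF.
have R_kempe v b : R v -> missing phi v b -> kempe phi a b v x.
  by case/R_path=> p [yp p_uniq ->] vb; apply: kempe_fan e_0 Ee xa yp p_uniq vb.
have R_disjoint v w b : R v -> R w -> missing phi v b -> missing phi w b -> v = w.
  move=> Rv Rw vb wb; apply: (kempe_disjoint opt.1 xa _ _ vb wb); auto.
have x_uses v c : R v -> missing phi v c -> uses phi x c.
  by case/R_path=> p [yp p_uniq ->]; apply: centre_uses_fan e_0 Ee yp p_uniq.
pose F := [set f | (0 < phi f) && [exists v, R v && (ends G f == [set x; v])]].
have F_size : #|F| < \sum_(v | R v) multiplicity G x v.
  apply: leq_trans (leq_card_bigcup _ _).
  have -> : #|F|.+1 = #|e |: F| by rewrite cardsU1 inE e_0.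
  apply/subset_leq_card/subsetP => f; rewrite in_setU1 => /orP[/eqP->|].
    by apply/bigcupP; exists y; rewrite ?inE ?Ee //; apply: connect0.
  rewrite inE => /andP[_ /existsP[v /andP[Rv Ef]]].
  by apply/bigcupP; exists v; rewrite ?inE.
have := F_size; rewrite ltnNge => /negP[].
apply: (@leq_trans (\sum_(v | R v) slack phi v)).
  by apply: leq_sum => v Rv; apply: slack_multiplicity; apply: R_neq.
pose Fv v := [set f | (x \in ends G f) && missing phi v (phi f)].
apply: (@leq_trans (\sum_(v | R v) #|Fv v|)).
  by apply: leq_sum => v Rv; apply: slack_card => c; apply: x_uses.
have Fv_F v f : R v -> f \in Fv v -> f \in F.
  move=> Rv; rewrite !inE => /andP[xf vf].
  have /andP[/andP[-> _] _] := vf; have [w _ Ef] := ends_other xf.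
  apply/existsP; exists w; rewrite Ef eqxx andbT.
  by apply: connect_trans Rv (connect1 _); apply/existsP; exists f; rewrite Ef eqxx.
rewrite -sum1_card.
under eq_bigr => v Rv do rewrite -sum1_card big_mkcond /=.
(* Double counting: after exchanging the sums, each edge counts at most once, as its colour is
   missing at no more than one vertex of [R]. *)
rewrite exchange_big /= [leqRHS]big_mkcond /=; apply: leq_sum => f _.
have [/existsP[v /andP[Rv vf]]|/existsPn none] := boolP [exists v, R v && (f \in Fv v)].
  rewrite (Fv_F v) // (bigD1 v) //= vf big1 // => w /andP[Rw wNv].
  case: ifP => // wf; case/eqP: wNv; move: vf wf; rewrite !inE.
  by move=> /andP[_ vf] /andP[_ wf]; apply: R_disjoint wf vf.
rewrite big1 // => v Rv; case: ifP => // vf; have := none v.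
by rewrite Rv vf.
Qed.

End Colourings.

Theorem theorem1p1 (V E : finType) (G : multigraph V E) :
  exists phi : E -> nat,
    [/\ forall e : E, 0 < phi e, proper_colouring G phi & local_colouring G phi].
Proof.
pose palette v := degree G v + max_multiplicity G v.
have [phi opt] := optimal_exists G palette.
have pos e : 0 < discard G palette phi e.
  apply: (optimal_coloured (palette := palette) _ e (optimal_discard opt)).
  by move=> v; apply: leqnn.
exists (discard G palette phi); split=> // [e f v eNf ve vf|e x y Ee].
  have /partial_properP phiP := discard_proper palette opt.1.
  apply/eqP=> /(phiP e f v eNf ve vf) e_0.
  by move: (pos e); rewrite e_0.
(* An edge kept has a colour within the palette of one of its ends; the value 0 of a discarded one
   satisfies the bound trivially. *)
rewrite /discard; case: existsP => // -[v]; rewrite Ee !inE leq_max.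
by case/andP=> /orP[] /eqP-> ->; rewrite ?orbT.
Qed.
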